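(* For every positive integer $n$ there exists a polytope $P$ in $\mathbb{R}^n$ that has exactly one integer point in its interior, has $2(2^n-1)$ facets, and has one integer point in the relative interior of each facet. Thus all ($2(2^n-1)$ facet-defining) inequalities of $P$ are necessary in the sense that the removal of any inequality from $P$ results in the inclusion of at least one additional integer point in the interior. As a consequence, the upper bound $c(n,k)\le \lceil 2(k+1)/3\rceil 2^n-2\lceil 2(k+1)/3\rceil+2$ is tight for $k=1$, that is, $c(n,1)=2(2^n-1)$.
   Context: For non-negative integers $n,k$, $c(n,k)$ denotes the minimal constant such that for every polyhedron $\{x\in\mathbb{R}^n : Ax\le b\}$ ($A\in\mathbb{R}^{m\times n}$, $b\in\mathbb{R}^m$, $m$ arbitrary) containing exactly $k$ integer points there is a subset $S$ of the rows of $A$, of cardinality at most $c(n,k)$, such that the polyhedron $\{x\in\mathbb{R}^n : A_Sx\le b_S\}$ has exactly the same $k$ integer points. Here $A_S$, $b_S$ denote the restrictions of $A$, $b$ to the rows indexed by $S$. An integer point is an element of $\mathbb{Z}^n$. *)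

(* Defs.v *)
From HB Require Import structures.
From mathcomp Require Import all_boot all_order all_algebra.
From mathcomp Require Import all_classical all_reals all_analysis.
Set Implicit Arguments.
Unset Strict Implicit.
Unset Printing Implicit Defensive.
Import Order.TTheory GRing.Theory Num.Theory.
Import numFieldNormedType.Exports.
Local Open Scope classical_set_scope.
Local Open Scope card_scope.
Local Open Scope ring_scope.

(* The subsystem A_S x <= b_S of A x <= b. *)
Definition polyhedron_on (R : realType) (m n : nat) (A : 'M[R]_(m, n))
    (b : 'cV[R]_m) (S : {set 'I_m}) : set 'cV[R]_n :=
  [set x | forall i, i \in S -> (A *m x) i ord0 <= b i ord0].

Definition polyhedron (R : realType) (m n : nat) (A : 'M[R]_(m, n))
    (b : 'cV[R]_m) : set 'cV[R]_n :=
  [set x | forall i, (A *m x) i ord0 <= b i ord0].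

Definition polytope (R : realType) (n : nat) (P : set 'cV[R]_n) : Prop :=
  (exists m (A : 'M[R]_(m, n)) (b : 'cV[R]_m), P = polyhedron A b) /\
  bounded_set P.

Definition int_point (R : realType) (n : nat) : set 'cV[R]_n :=
  [set x | forall i, x i ord0 \is a Num.int].

Definition face (R : realType) (n : nat) (P F : set 'cV[R]_n) : Prop :=
  F !=set0 /\
  exists (c : 'rV[R]_n) (d : R),
    (forall x, P x -> (c *m x) ord0 ord0 <= d) /\
    F = P `&` [set x | (c *m x) ord0 ord0 = d].

(* Inclusionwise maximal faces other than P itself. *)
Definition facets (R : realType) (n : nat) (P : set 'cV[R]_n) :
    set (set 'cV[R]_n) :=
  [set F | [/\ face P F, F <> P &
    forall G, face P G -> G <> P -> F `<=` G -> G = F]].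

Definition affine_hull (R : realType) (n : nat) (F : set 'cV[R]_n) :
    set 'cV[R]_n :=
  [set y | exists k (w : 'I_k -> R) (v : 'I_k -> 'cV[R]_n),
    [/\ forall i, F (v i), \sum_i w i = 1 & y = \sum_i w i *: v i]].

Definition rel_interior (R : realType) (n : nat) (F : set 'cV[R]_n) :
    set 'cV[R]_n :=
  [set x | F x /\ \forall y \near x, affine_hull F y -> F y].

(* A x <= b describes P with exactly one inequality per facet of P. *)
Definition facet_description (R : realType) (m n : nat) (A : 'M[R]_(m, n))
    (b : 'cV[R]_m) (P : set 'cV[R]_n) : Prop :=
  P = polyhedron A b /\
  set_bij [set: 'I_m] (facets P)
    (fun i => P `&` [set x | (A *m x) i ord0 = b i ord0]).

(* Every system with exactly k integer solutions has a subsystem of at most c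
   inequalities with the same integer solutions. *)
Definition helly_bound (R : realType) (n k c : nat) : Prop :=
  forall (m : nat) (A : 'M[R]_(m, n)) (b : 'cV[R]_m),
    polyhedron A b `&` @int_point R n #= `I_k ->
    exists S : {set 'I_m}, (#|S| <= c)%N /\
      polyhedron_on A b S `&` @int_point R n =
      polyhedron A b `&` @int_point R n.

(* c is the constant c(n,k); the existence of some bound is not presupposed. *)
Definition is_c (R : realType) (n k c : nat) : Prop :=
  helly_bound R n k c /\
  forall c' : nat, helly_bound R n k c' -> (c <= c')%N.

Definition c_upper (n k : nat) : int :=
  let q : int := Num.ceil ((2 * (k + 1))%N%:R / 3%:R : rat) in
  q * 2 ^+ n - 2 * q + 2.

(* Main.v *)
Require Import Defs.
From HB Require Import structures.
From mathcomp Require Import all_boot all_order all_algebra.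
From mathcomp Require Import all_classical all_reals all_analysis.
From mathcomp Require Import zify lra.
Set Implicit Arguments.
Unset Strict Implicit.
Unset Printing Implicit Defensive.
Import Order.TTheory GRing.Theory Num.Theory.
Import numFieldNormedType.Exports.
Local Open Scope classical_set_scope.
Local Open Scope card_scope.
Local Open Scope ring_scope.

(** The polytope is twice the Voronoi cell of the integer lattice for Voronoi's
    principal form of the first type, sum_i x_i^2 + sum_(i<j) (x_i - x_j)^2.
    Adjoin a coordinate x_None = 0 and, for a nonempty proper subset U of the
    n+1 indices, let cut U x be the sum of x_a - x_c over all a in U and c
    outside U; the inequalities are cut U x <= |U| (n+1 - |U|), and there are
    2^(n+1) - 2 of them.

    Its integer points are found without any lattice theory. If x is integral
    and nonzero, some level set U = {x >= x_a} is nonempty and proper, and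
    every term x_a - x_c of cut U x is at least 1; hence cut U x is at least
    the number of terms, and if x satisfies the inequality of U then every
    term is 1, so that x is the indicator of U normalised to vanish at None
    (int_point_cut). Conversely this point, the corner of U, is tight for U and
    strict for all the other inequalities, since differences of an indicator
    are at most 1 (corner_tight_only_at). So 0 is the only integer point of the
    interior, and every inequality owns exactly one integer point of the
    boundary. A system with a strict solution and with, for each row, a point
    tight for that row only has exactly one facet per row
    (irredundant_facet_description), which gives all the claims about facets.
    Lowering every right-hand side by 1 cuts off precisely the corners, and
    then no inequality can be omitted, whence c(n,1) >= 2 (2^n - 1).

    For the upper bound (helly_bound1), take an inclusionwise irredundant
    subsystem with the same single integer point o, and push its inequalities
    outwards, among the finitely many integer points of a large box, as far as
    o remains the only strict solution (push_out). Then each inequality i is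
    attained at an integer point z_i that satisfies all the others strictly.
    If z_i and z_j agree modulo 2, their midpoint is an integral strict
    solution, so it is o; hence no z_i is congruent to o, and each of the
    2^n - 1 other classes contains at most two z_i, a point and its reflection
    in o (card_midpoint_bound). *)

(** * Faces of a polyhedron lie in its tight sets *)

Definition tight_at (R : realType) (m n : nat) (A : 'M[R]_(m, n))
    (b : 'cV[R]_m) (i : 'I_m) : set 'cV[R]_n :=
  polyhedron A b `&` [set x | (A *m x) i ord0 = b i ord0].

Lemma mulmx_coord_continuous (R : realType) (m n : nat) (A : 'M[R]_(m, n))
    (i : 'I_m) : continuous (fun x : 'cV[R]_n => (A *m x) i ord0).
Proof.
have -> : (fun y : 'cV[R]_n => (A *m y) i ord0) =
    (fun y => \sum_j A i j * y j ord0) by apply/funext => y; rewrite mxE.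
apply: (@continuous_big R 'I_n +%R 0 xpredT _ 'cV[R]_n (index_enum 'I_n)
  (fun j y => A i j * y j ord0)); first exact: add_continuous.
move=> j _ x; apply: continuousM; first exact: cst_continuous.
exact: coord_continuous.
Qed.

Lemma near_mulmx_lt (R : realType) (m n : nat) (A : 'M[R]_(m, n))
    (b : 'cV[R]_m) (i : 'I_m) (x : 'cV[R]_n) :
  (A *m x) i ord0 < b i ord0 -> \forall y \near x, (A *m y) i ord0 < b i ord0.
Proof. by move=> ?; apply: (cvgr_lt _ (@mulmx_coord_continuous _ _ _ A i x)). Qed.

Lemma near_ray (R : realType) (n : nat) (x v : 'cV[R]_n) (Q : set 'cV[R]_n) :
  (\forall y \near x, Q y) -> exists2 t : R, 0 < t & Q (x + t *: v).
Proof.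
move=> Qx.
have c : (x + t *: v) @[t --> (0:R)] --> x.
  rewrite -[X in _ --> X]addr0 -(scale0r v).
  apply: cvgD; first exact: cvg_cst.
  apply: (@cvgZr_tmp R _ R^o (nbhs (0 : R^o)) _ id); exact: cvg_id.
have /= := c _ Qx; rewrite /= => /nbhs_ballP [e /= e0 he].
exists (e / 2); first by rewrite divr_gt0.
apply: he; rewrite /ball /= sub0r normrN gtr0_norm ?divr_gt0//.
by rewrite ltr_pdivrMr// ltr_pMr// ltr1n.
Qed.

Lemma face_midpoint (R : realType) (m n : nat) (A : 'M[R]_(m, n))
    (b : 'cV[R]_m) (G : set 'cV[R]_n) (x y : 'cV[R]_n) :
  face (polyhedron A b) G -> G x -> G y -> G (2^-1 *: (x + y)).
Proof.
move=> [_ [c [d [_ ->]]]] [/= Px cx] [/= Py cy]; split.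
  move=> i; rewrite -scalemxAr mulmxDr !mxE.
  have := Px i; have := Py i; rewrite !mxE; lra.
rewrite /= -scalemxAr mulmxDr mxE [X in _ * X]mxE cx cy; lra.
Qed.

(** Otherwise the face contains a point strict for every inequality: a point
    with as few tight inequalities as possible, since averaging with a point
    loose at i removes i from the tight set. The functional defining the face
    then attains its maximum over the polyhedron at an interior point, so it
    is constant and the face is the whole polyhedron. *)
Lemma face_sub_tight (R : realType) (m n : nat) (A : 'M[R]_(m, n))
    (b : 'cV[R]_m) (G : set 'cV[R]_n) :
  face (polyhedron A b) G -> G <> polyhedron A b ->
  exists i, G `<=` tight_at A b i.
Proof.
move=> fG GP; apply: contrapT => /forallNP nG.
have PG x : G x -> polyhedron A b x by case: fG => _ [c [d [_ ->]]] [].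
have loose i : exists2 x, G x & (A *m x) i ord0 < b i ord0.
  have /existsNP[x /not_implyP[Gx nx]] := nG i; exists x => //.
  rewrite lt_neqAle (PG _ Gx i) andbT; apply/eqP => e.
  by apply: nx; split => //; exact: PG.
pose T (x : 'cV[R]_n) := [set i | (A *m x) i ord0 == b i ord0]%SET.
have [x Gx Tx] : exists2 x, G x & T x = finset.set0.
  have [x0 Gx0] := fG.1.
  have [k] := ubnP #|T x0|; elim: k x0 Gx0 => // k IH x0 Gx0 /ltnSE Tk.
  have [e|[i]] := set_0Vmem (T x0); first by exists x0.
  rewrite !inE => /eqP ti; have [y Gy yi] := loose i.
  apply: (IH (2^-1 *: (x0 + y))); first exact: face_midpoint fG Gx0 Gy.
  apply: leq_trans Tk; apply: proper_card; apply/properP; split.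
    apply/fintype.subsetP => j; rewrite !inE => /eqP.
    rewrite -scalemxAr mulmxDr mxE [X in _ * X]mxE => e.
    rewrite eq_le (PG _ Gx0 j) /=.
    by have := PG _ Gy j; lra.
  exists i; rewrite !inE ?ti//.
  rewrite -scalemxAr mulmxDr mxE [X in _ * X]mxE ti; apply/eqP; lra.
have sx i : (A *m x) i ord0 < b i ord0.
  rewrite lt_neqAle (PG _ Gx i) andbT; apply/negP => e.
  by have := finset.in_set0 i; rewrite -Tx inE e.
have Px : \forall y \near x, polyhedron A b y.
  have : \forall y \near x, forall i, (A *m y) i ord0 < b i ord0.
    apply: (@filter_forall _ _ (fun i y => (A *m y) i ord0 < b i ord0)
      (nbhs x)) => i.
    exact: near_mulmx_lt.
  by apply: filterS => y hy i; exact: ltW.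
case: fG => _ [c [d [cd EG]]]; apply: GP.
rewrite EG; apply/seteqP; split=> [p []//|p Pp]; split=> //=.
move: Gx; rewrite EG => -[_ /= cx].
(* The ray from p through x stays in the polyhedron a little beyond x. *)
have [t t0 /cd] := near_ray (x - p) Px.
rewrite mulmxDr -scalemxAr mulmxBr.
have := cd _ Pp; move: cx; rewrite !mxE => -> cp.
rewrite gerDl pmulr_rle0// subr_le0 => dp.
by apply/eqP; rewrite eq_le cp.
Qed.

(** * Facets of an irredundant system *)

Definition tight_only_at (R : realType) (m n : nat) (A : 'M[R]_(m, n))
    (b : 'cV[R]_m) (i : 'I_m) (x : 'cV[R]_n) : Prop :=
  (A *m x) i ord0 = b i ord0 /\
  forall j, j != i -> (A *m x) j ord0 < b j ord0.

Lemma tight_only_at_mem (R : realType) (m n : nat) (A : 'M[R]_(m, n))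
    (b : 'cV[R]_m) (i : 'I_m) (x : 'cV[R]_n) :
  tight_only_at A b i x -> tight_at A b i x.
Proof.
move=> [xi xj]; split=> // j.
by have [->|/xj/ltW//] := eqVneq j i; rewrite xi.
Qed.

Lemma tight_only_at_uniq (R : realType) (m n : nat) (A : 'M[R]_(m, n))
    (b : 'cV[R]_m) (i j : 'I_m) (x : 'cV[R]_n) :
  tight_only_at A b i x -> tight_at A b j x -> j = i.
Proof.
move=> [_ xj] [_ /= e]; apply/eqP/negPn/negP => /xj.
by rewrite e ltxx.
Qed.

Lemma interior_polyhedron_on (R : realType) (m n : nat) (A : 'M[R]_(m, n))
    (b : 'cV[R]_m) (S : {set 'I_m}) (x : 'cV[R]_n) :
  (forall i, i \in S -> (A *m x) i ord0 < b i ord0) ->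
  interior (polyhedron_on A b S) x.
Proof.
move=> hx; rewrite /interior /=.
have : \forall y \near x, forall i, i \in S -> (A *m y) i ord0 < b i ord0.
  apply: (@filter_forall _ _
    (fun i y => i \in S -> (A *m y) i ord0 < b i ord0) (nbhs x)) => i.
  have [iS|niS] := boolP (i \in S); last by apply: nearW => y.
  by apply: filterS (near_mulmx_lt (hx i iS)) => y.
by apply: filterS => y hy i iS; apply/ltW/hy.
Qed.

Lemma polyhedron_onT (R : realType) (m n : nat) (A : 'M[R]_(m, n))
    (b : 'cV[R]_m) : polyhedron_on A b [set: 'I_m]%SET = polyhedron A b.
Proof.
by apply/seteqP; split=> x hx i; [apply: hx; rewrite finset.in_setT|move=> _].
Qed.

(** The ray from the strict point x0 through x leaves the polyhedron at x. *)
Lemma tight_not_interior (R : realType) (m n : nat) (A : 'M[R]_(m, n))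
    (b : 'cV[R]_m) (x0 x : 'cV[R]_n) (i : 'I_m) :
  (A *m x0) i ord0 < b i ord0 -> (A *m x) i ord0 = b i ord0 ->
  ~ interior (polyhedron A b) x.
Proof.
move=> x0i xi Px; have [t t0 /(_ i)] := near_ray (x - x0) Px.
rewrite mulmxDr -scalemxAr mulmxBr.
move: x0i xi; rewrite !mxE => x0i ->.
by rewrite gerDl pmulr_rle0// subr_le0 leNgt x0i.
Qed.

(** Near x the other inequalities stay strict, and the affine hull of the face
    preserves the equation of row i. *)
Lemma rel_interior_tight (R : realType) (m n : nat) (A : 'M[R]_(m, n))
    (b : 'cV[R]_m) (i : 'I_m) (x : 'cV[R]_n) :
  tight_only_at A b i x -> rel_interior (tight_at A b i) x.
Proof.
move=> xi; split; first exact: tight_only_at_mem.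
have : interior (polyhedron_on A b [set~ i]%SET) x.
  by apply: interior_polyhedron_on => j; rewrite !inE; exact: xi.2.
apply: filterS => y yP [k [w [v [Fv w1 yE]]]].
have yi : (A *m y) i ord0 = b i ord0.
  rewrite yE mulmx_sumr summxE.
  under eq_bigr => l _ do rewrite -scalemxAr mxE (Fv l).2.
  by rewrite -mulr_suml w1 mul1r.
split=> // j; have [->|ji] := eqVneq j i; first by rewrite yi.
by apply: yP; rewrite !inE.
Qed.

(** The point p i lies in no other tight set. As every proper face lies in some
    tight set, the tight sets are thus the maximal proper faces, and distinct
    rows give distinct ones. *)
Lemma irredundant_facet_description (R : realType) (m n : nat)
    (A : 'M[R]_(m, n)) (b : 'cV[R]_m) (x0 : 'cV[R]_n) (p : 'I_m -> 'cV[R]_n) :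
  (forall i, (A *m x0) i ord0 < b i ord0) ->
  (forall i, tight_only_at A b i (p i)) ->
  facet_description A b (polyhedron A b).
Proof.
move=> x0lt pi; split=> //.
have tight_neq i : tight_at A b i <> polyhedron A b.
  move=> e; have : tight_at A b i x0 by rewrite e => j; exact: ltW.
  by move=> [_ /= h]; have := x0lt i; rewrite h ltxx.
have tight_face i : face (polyhedron A b) (tight_at A b i).
  split; first by exists (p i); exact: tight_only_at_mem.
  exists (row i A), (b i ord0).
  have rowE (x : 'cV[R]_n) : (row i A *m x) ord0 ord0 = (A *m x) i ord0.
    by rewrite -row_mul mxE.
  split=> [x /(_ i)|]; first by rewrite rowE.
  by apply/seteqP; split=> x [Px] /= e; split=> //=; rewrite ?rowE// -rowE.
have tight_max i G : face (polyhedron A b) G -> G <> polyhedron A b ->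
    tight_at A b i `<=` G -> G = tight_at A b i.
  move=> fG GP iG; have [j Gj] := face_sub_tight fG GP.
  apply/seteqP; split=> //.
  suff <- : j = i by [].
  exact: tight_only_at_uniq (pi i) (Gj _ (iG _ (tight_only_at_mem (pi i)))).
split.
- by move=> i _; split=> [||G]; [exact: tight_face|exact: tight_neq|
    exact: tight_max].
- move=> i j _ _ e; apply/esym.
  apply: (tight_only_at_uniq (pi i)); rewrite /tight_at -e.
  exact: tight_only_at_mem.
- move=> G [fG GP Gmax]; have [i Gi] := face_sub_tight fG GP.
  exists i => //; exact: (Gmax _ (tight_face i) (tight_neq i) Gi).
Qed.

(** If G is the only facet through z, then the other rows, having other facets,
    are strict at z. This holds for every description of P, not only for the
    one by which P was built. *)
Lemma facet_description_drop (R : realType) (m n : nat) (A : 'M[R]_(m, n))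
    (b : 'cV[R]_m) (P : set 'cV[R]_n) (i : 'I_m) (z : 'cV[R]_n) :
  facet_description A b P -> tight_at A b i z ->
  (forall G, facets P G -> G z -> G = tight_at A b i) ->
  interior (polyhedron_on A b [set~ i]%SET) z.
Proof.
move=> [-> [fun_t inj_t _]] zi zG.
apply: interior_polyhedron_on => j; rewrite !inE => ji.
rewrite lt_neqAle (zi.1 j) andbT; apply: contra ji => /eqP e.
apply/eqP/inj_t; rewrite ?in_setT//.
by apply: zG; [exact: fun_t|split=> //; exact: zi.1].
Qed.

(** * Pushing inequalities outwards and counting parity classes *)

(** Choose thresholds of the form v i (f i), beyond b i, for which o is the only
    strict solution, and such that the total number of points of X strictly
    below the thresholds is maximal. Moving the threshold of i up to the next
    value taken at a point strict for the others would increase this number,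
    so the present threshold is already such a value. *)
Lemma push_out (d : Order.disp_t) (V : orderType d) (I X : finType)
    (v : I -> X -> V) (b : I -> V) (o : X) :
  (forall x, (forall i, (v i x <= b i)%O) <-> x = o) ->
  (forall i, exists2 w, (b i < v i w)%O &
     forall j, j != i -> (v j w <= b j)%O) ->
  exists z : I -> X,
    (forall i j, j != i -> (v j (z i) < v j (z j))%O) /\
    (forall x, (forall i, (v i x < v i (z i))%O) <-> x = o).
Proof.
move=> feas needed.
have /choice [w /all_and2 [w_viol w_ok]] : forall i, exists w,
    (b i < v i w)%O /\ forall j, j != i -> (v j w <= b j)%O.
  by move=> i; have [w] := needed i; exists w.
pose good (f : {ffun I -> X}) := [forall i, (b i < v i (f i))%O] &&
  [forall x, [forall i, (v i x < v i (f i))%O] ==> (x == o)].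
pose Phi (f : {ffun I -> X}) :=
  (\sum_i #|[set x | (v i x < v i (f i))%O]%SET|)%N.
(* The smallest values beyond b give the same solutions, as strict ones. *)
pose f0 := [ffun i => [arg min_(x < w i | (b i < v i x)%O) v i x]%O].
have good0 : good f0.
  apply/andP; split.
    by apply/forallP => i; rewrite ffunE; case: arg_minP.
  apply/forallP => x; apply/implyP => /forallP xf; apply/eqP/feas => i.
  rewrite leNgt; apply/negP => bx; have := xf i; rewrite ffunE.
  by case: arg_minP => // y _ /(_ x bx) yx; rewrite ltNge yx.
have [f good_f fmax] : exists2 f, good f &
    forall g, good g -> (Phi g <= Phi f)%N.
  by case: (arg_maxnP Phi good0) => f; exists f.
have /andP [/forallP fb /forallP fo] := good_f.
have {}fo x : (forall i, (v i x < v i (f i))%O) -> x = o.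
  by move=> h; apply/eqP; have /implyP := fo x; apply; apply/forallP.
have bo i : (v i o <= b i)%O by have /feas := erefl o; apply.
have /choice [z /all_and2 [z_tight z_lt]] : forall i, exists y,
    v i y = v i (f i) /\ forall j, j != i -> (v j y < v j (f j))%O.
  move=> i.
  pose Q y := [forall (j | j != i), (v j y < v j (f j))%O] &&
    (v i (f i) <= v i y)%O.
  have Qw : Q (w i).
    apply/andP; split.
      by apply/forall_inP => j ji; apply: le_lt_trans (w_ok i j ji) (fb j).
    rewrite leNgt; apply/negP => wlt.
    have wo : w i = o.
      apply: fo => j; have [->//|ji] := eqVneq j i.
      by apply: le_lt_trans (w_ok i j ji) (fb j).
    by have := w_viol i; rewrite wo ltNge bo.
  have [y /andP [/forall_inP yj yi] ymin] : exists2 y, Q y &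
      forall x, Q x -> (v i y <= v i x)%O.
    by case: (arg_minP (v i) Qw) => y; exists y.
  exists y; split=> //; apply/eqP; rewrite eq_le yi andbT leNgt; apply/negP => fy.
  pose g := [ffun j => if j == i then y else f j].
  have good_g : good g.
    apply/andP; split; apply/forallP.
      by move=> j; rewrite ffunE; case: eqP => [->|//]; apply: lt_trans fy.
    move=> x; apply/implyP => /forallP xg.
    have xj j : j != i -> (v j x < v j (f j))%O.
      by move=> ji; have := xg j; rewrite ffunE (negPf ji).
    apply/eqP/fo => j; have [->|/xj//] := eqVneq j i.
    rewrite ltNge; apply/negP => fx.
    have Qx : Q x by rewrite /Q fx andbT; apply/forall_inP.
    by have := xg i; rewrite ffunE eqxx ltNge ymin.
  have := fmax g good_g; apply/negP; rewrite -ltnNge.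
  rewrite /Phi [X in (X < _)%N](bigD1 i)//= [X in (_ < X)%N](bigD1 i)//=.
  rewrite -addSn leq_add//; last first.
    by apply: leq_sum => j ji; rewrite ffunE (negPf ji).
  rewrite ffunE eqxx; apply: proper_card; apply/properP; split.
    by apply/fintype.subsetP => x; rewrite !inE => /lt_trans; apply.
  by exists (f i); rewrite !inE ?ltxx.
exists z; split=> [i j ji|x].
  by rewrite z_tight; exact: z_lt.
split=> [xz|->]; last by move=> i; rewrite z_tight; exact: le_lt_trans (fb i).
by apply: fo => i; rewrite -z_tight.
Qed.

(** Two points of one class have a strictly feasible midpoint, because each is
    strict where the other is tight; so the midpoint is o. Thus the class of o
    contains no z i, as o is also the midpoint of o and itself, and any other class
    contains at most two of them, as z j is determined by z i and the midpoint
    o. *)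
Lemma card_midpoint_bound (d : Order.disp_t) (V : orderType d)
    (I X C : finType) (cls : X -> C) (mid : X -> X -> X) (v : I -> X -> V)
    (o : X) (z : I -> X) :
  (forall x, mid x x = x) ->
  (forall x y y', cls x = cls y -> cls x = cls y' ->
     mid x y = mid x y' -> y = y') ->
  (forall i x y t, cls x = cls y -> (v i x <= t)%O -> (v i y <= t)%O ->
     (v i x < t)%O || (v i y < t)%O -> (v i (mid x y) < t)%O) ->
  (forall i j, j != i -> (v j (z i) < v j (z j))%O) ->
  (forall x, (forall i, (v i x < v i (z i))%O) <-> x = o) ->
  (#|I| <= 2 * (#|C| - 1))%N.
Proof.
move=> midxx mid_inj mid_lt z_lt zo.
have z_le i j : (v j (z i) <= v j (z j))%O.
  by have [->//|/z_lt/ltW] := eqVneq j i.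
have o_lt i : (v i o < v i (z i))%O by have /zo := erefl o; apply.
have zo_cls i : cls (z i) != cls o.
  apply/eqP => e; suff zi : z i = o by have := o_lt i; rewrite zi ltxx.
  apply: (mid_inj o); rewrite ?e// midxx; apply/zo => j.
  by apply: mid_lt; rewrite ?o_lt ?z_le ?e// ltW.
have z_mid i j : i != j -> cls (z i) = cls (z j) -> mid (z i) (z j) = o.
  move=> ij e; apply/zo => k; apply: mid_lt => //.
  have [->|/z_lt->//] := eqVneq k i.
  by rewrite (z_lt j i ij) orbT.
have fiber c : (#|[pred i | cls (z i) == c]| <= 2)%N.
  have [i ic|/eq_card0->//] := pickP [pred i | cls (z i) == c].
  rewrite (cardD1 i) [i \in _]ic add1n ltnS; apply/card_le1_eqP => j k.
  rewrite !inE => /andP [ji /eqP jc] /andP [ki /eqP kc].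
  move: ic; rewrite /= => /eqP ic.
  have e : z j = z k.
    apply: (mid_inj (z i)); rewrite ?ic ?jc ?kc//.
    by rewrite !z_mid ?ic ?jc ?kc// eq_sym.
  apply/eqP/negPn/negP => jk; have := z_lt j k jk.
  by rewrite e ltxx.
rewrite -sum1_card (partition_big (cls \o z) (predC1 (cls o)))//=.
apply: (@leq_trans (\sum_(c in predC1 (cls o)) 2)%N).
  by apply: leq_sum => c _; have := fiber c; rewrite -sum1_card.
by rewrite sum_nat_const cardC1 mulnC subn1.
Qed.

(** * Integer points of a box, up to congruence modulo 2 *)

(** The box [-K, K]^n is encoded by natural numbers, shifted by K, so that
    parity and halving are those of nat. *)
Definition box_point (R : realType) (n K : nat)
    (x : {ffun 'I_n -> 'I_(K.*2.+1)}) : 'cV[R]_n :=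
  \col_i ((x i)%:R - K%:R).

Definition box_mid (n K : nat) (x y : {ffun 'I_n -> 'I_(K.*2.+1)}) :
    {ffun 'I_n -> 'I_(K.*2.+1)} :=
  [ffun i => inord (x i + y i)./2].

Definition box_parity (n K : nat) (x : {ffun 'I_n -> 'I_(K.*2.+1)}) :
    {ffun 'I_n -> bool} :=
  [ffun i => odd (x i)].

Lemma box_point_int (R : realType) (n K : nat)
    (x : {ffun 'I_n -> 'I_(K.*2.+1)}) : int_point (box_point R x).
Proof. by move=> i; rewrite mxE rpredB// natr_int. Qed.

Lemma box_point_inj (R : realType) (n K : nat) :
  injective (@box_point R n K).
Proof.
move=> x y /matrixP e; apply/ffunP => i; apply/val_inj/eqP.
by have /eqP := e i ord0; rewrite !mxE (inj_eq (addIr _)) eqr_nat.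
Qed.

Lemma int_pointP (R : realType) (n K : nat) (z : 'cV[R]_n) :
  int_point z -> (forall i, `|z i ord0| <= K%:R) ->
  exists x : {ffun 'I_n -> 'I_(K.*2.+1)}, box_point R x = z.
Proof.
move=> z_int zK.
have /choice [x xz] : forall i, exists k : 'I_(K.*2.+1),
    k%:R - K%:R = z i ord0.
  move=> i; have /intrP [m zm] := z_int i; have := zK i.
  rewrite zm -[K%:R]/(K%:Z%:~R) -intr_norm ler_int ler_norml => /andP [m1 m2].
  pose k := absz (m + K%:Z).
  have kE : k%:Z = m + K%:Z by rewrite /k; lia.
  have mK : (k < K.*2.+1)%N by lia.
  exists (Ordinal mK) => /=.
  by rewrite -[X in X - _]/(k%:Z%:~R) kE intrD addrK.
exists [ffun i => x i]; apply/matrixP => i j.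
by rewrite mxE ffunE xz [j]ord1.
Qed.

Lemma box_point_mid (R : realType) (n K : nat)
    (x y : {ffun 'I_n -> 'I_(K.*2.+1)}) :
  box_parity x = box_parity y ->
  box_point R (box_mid x y) = 2^-1 *: (box_point R x + box_point R y).
Proof.
move=> /ffunP e; apply/matrixP => i j; rewrite !mxE ffunE.
have := e i; rewrite !ffunE => oxy.
have xK := ltn_ord (x i); have yK := ltn_ord (y i).
rewrite inordK; last by lia.
have /(congr1 (fun k => k%:R : R)) : ((x i + y i)./2.*2 = x i + y i)%N.
  by have := odd_double_half (x i + y i); rewrite oddD oxy addbb.
by rewrite -muln2 natrM natrD => h; lra.
Qed.

(** * The upper bound for one integer point *)

Lemma minimal_subsystem (R : realType) (m n : nat) (A : 'M[R]_(m, n))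
    (b : 'cV[R]_m) (Z : set 'cV[R]_n) :
  exists S : {set 'I_m},
    polyhedron_on A b S `&` Z = polyhedron A b `&` Z /\
    forall i, i \in S -> exists w, [/\ Z w, b i ord0 < (A *m w) i ord0 &
      forall j, j \in S -> j != i -> (A *m w) j ord0 <= b j ord0].
Proof.
pose same S := `[< polyhedron_on A b S `&` Z = polyhedron A b `&` Z >].
have sameT : same [set: 'I_m]%SET by apply/asboolP; rewrite polyhedron_onT.
case: (arg_minnP (fun S : {set 'I_m} => #|S|) sameT) => S /asboolP eS minS.
exists S; split=> // i iS; apply: contrapT => now.
have : same (S :\ i)%SET.
  apply/asboolP; rewrite -eS; apply/seteqP; split=> w [wP wZ]; split=> // j jS.
    have [->|ji] := eqVneq j i; last by apply: wP; rewrite !inE ji.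
    rewrite leNgt; apply/negP => bw; apply: now; exists w; split=> // k kS ki.
    by apply: wP; rewrite !inE ki.
  by apply: wP; move: jS; rewrite !inE => /andP[].
by move=> /minS; rewrite (cardsD1 i S) iS add1n ltnn.
Qed.


Lemma card_eq_I1 (T : Type) (Z : set T) : Z #= `I_1 -> exists c, Z = [set c].
Proof.
move=> /eq_cardSP [z Zz]; rewrite II0 card_eq0 => /eqP e; exists z.
apply/seteqP; split=> [x Zx|x ->//]; apply: contrapT => xo.
by rewrite -[False]/(@set0 T x) -e.
Qed.

Lemma finite_coords_bound (R : realType) (n : nat) (I : finType)
    (w : I -> 'cV[R]_n) :
  exists K : nat, forall k i, `|w k i ord0| <= K%:R.
Proof.
pose M := \sum_k \sum_i `|w k i ord0|.
exists (Num.Def.archi_bound M) => k i.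
have M0 : 0 <= M by apply: sumr_ge0 => ? _; apply: sumr_ge0.
apply: le_trans (ltW (archi_boundP M0)).
rewrite /M (bigD1 k)//= (bigD1 i)//= -addrA lerDl.
by rewrite addr_ge0// sumr_ge0// => ? _; rewrite sumr_ge0.
Qed.

(** The box only has to contain the integer point of the polyhedron and, for
    each inequality of the minimal subsystem, one integer point that its
    omission would admit: as the box is closed under midpoints, the pushing
    and counting can then take place inside it. *)
Lemma helly_bound1 (R : realType) (n : nat) :
  helly_bound R n 1 (2 * (2 ^ n - 1)).
Proof.
move=> m A b /card_eq_I1 [c cE].
have [S [SE needed]] := minimal_subsystem A b (@int_point R n).
exists S; split=> //.
have cP x : polyhedron_on A b S x /\ int_point x <-> x = c.
  split=> [h|->].
    have : (polyhedron_on A b S `&` @int_point R n) x by [].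
    by rewrite SE cE.
  have : (polyhedron_on A b S `&` @int_point R n) c by rewrite SE cE.
  by [].
pose I : finType := {i : 'I_m | i \in S}.
have /choice [w wP] : forall i : I, exists w, [/\ int_point w,
    b (val i) ord0 < (A *m w) (val i) ord0 &
    forall j, j \in S -> j != val i -> (A *m w) j ord0 <= b j ord0].
  by move=> i; exact: needed (valP i).
have [K wK] := finite_coords_bound (fun k : option I => oapp w c k).
have int_c : int_point c by have /cP [] := erefl c.
have [c' c'E] := int_pointP int_c (wK None).
pose v (i : I) (x : {ffun 'I_n -> 'I_(K.*2.+1)}) :=
  (A *m box_point R x) (val i) ord0.
have [x|i|z [z_lt zo]] := @push_out _ R I _ v (fun i => b (val i) ord0) c'.
- split=> [xP|-> i]; last first.
    by rewrite /v c'E; have /cP [h _] := erefl c; exact: h (valP i).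
  apply: (@box_point_inj R); rewrite c'E; apply/cP; split.
    by move=> j jS; exact: xP (Sub j jS).
  exact: box_point_int.
- have [w_int w_viol w_ok] := wP i.
  have [x xE] := int_pointP w_int (wK (Some i)).
  by exists x => [|j ji]; rewrite /v xE//; apply: w_ok => //; exact: valP.
have -> : #|S| = #|I| by rewrite card_sig; apply: eq_card.
have -> : (2 ^ n)%N = #|{: {ffun 'I_n -> bool}}|.
  by rewrite card_ffun card_bool card_ord.
apply: (card_midpoint_bound (cls := @box_parity n K) (mid := @box_mid n K) _ _ _ z_lt zo).
- move=> x; apply: (@box_point_inj R).
  by rewrite box_point_mid//; apply/matrixP => i j; rewrite !mxE; lra.
- move=> x y y' xy xy' /(congr1 (@box_point R n K)).
  rewrite !box_point_mid// => /(scalerI _) e.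
  by apply/(@box_point_inj R)/(addrI (box_point R x))/e; rewrite invr_eq0 pnatr_eq0.
- move=> i x y t xy; rewrite /v box_point_mid// -scalemxAr mulmxDr.
  rewrite [X in _ -> _ -> _ -> X < _]mxE [X in _ -> _ -> _ -> _ * X < _]mxE.
  by move=> ? ? /orP []; lra.
Qed.

(** * Cut functionals *)

Definition cutset (T : finType) (U : {set T}) : {set T * T} := finset.setX U (~: U)%SET.

Definition cut (R : zmodType) (T : finType) (U : {set T}) (g : T -> R) : R :=
  \sum_(p in cutset U) (g p.1 - g p.2).

Definition proper_sets (T : finType) : {set {set T}} :=
  [set U | (U != finset.set0) && (U != [set: T])]%SET.

Lemma proper_setsP (T : finType) (U : {set T}) :
  reflect (exists a c, a \in U /\ c \notin U) (U \in proper_sets T).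
Proof.
rewrite inE; apply: (iffP andP) => [[/finset.set0Pn [a aU]]|[a [c [aU cU]]]].
  rewrite finset.eqEsubset finset.subsetT /= => /fintype.subsetPn [c _ cU].
  by exists a, c.
split; first by apply/finset.set0Pn; exists a.
by apply: contraNneq cU => ->; rewrite finset.in_setT.
Qed.

Lemma card_proper_sets (T : finType) :
  (0 < #|T|)%N -> #|proper_sets T| = (2 ^ #|T| - 2)%N.
Proof.
move=> T0; have -> : proper_sets T = (~: [set finset.set0; [set: T]])%SET.
  by apply/setP => U; rewrite !inE negb_or.
rewrite cardsCs finset.setCK cards2 -cardsT -powersetT card_powerset cardsT.
suff -> : (finset.set0 != [set: T]%SET) by [].
by rewrite eq_sym -cards_eq0 cardsT -lt0n.
Qed.

Lemma cutsetC (T : finType) (U : {set T}) (p : T * T) :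
  (p \in cutset (~: U)%SET) = ((p.2, p.1) \in cutset U).
Proof. by rewrite !inE negbK andbC. Qed.

Lemma cutC (R : zmodType) (T : finType) (U : {set T}) (g : T -> R) :
  cut (~: U)%SET g = - cut U g.
Proof.
pose sw (p : T * T) := (p.2, p.1).
rewrite /cut (reindex_onto sw sw) /=; last by case.
rewrite -sumrN; apply: eq_big => [[a c]|[a c] _] /=; last by rewrite opprB.
by rewrite cutsetC eqxx andbT.
Qed.

Lemma cut1 (R : zmodType) (T : finType) (a : T) (g : T -> R) :
  cut [set a]%SET g = \sum_c (g a - g c).
Proof.
rewrite (bigD1 a)//= subrr add0r /cut.
rewrite (reindex_onto (pair a) (fun p => p.2)) /=; last first.
  by case=> x y; rewrite !inE /= => /andP[/eqP->].
by apply: eq_bigl => c; rewrite !inE !eqxx andbT.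
Qed.

Lemma card_cutset1 (T : finType) (a : T) :
  (#|cutset [set a]%SET| <= #|T|)%N.
Proof. by rewrite cardsX cards1 mul1n max_card. Qed.

Lemma card_cutsetC (T : finType) (U : {set T}) :
  #|cutset (~: U)%SET| = #|cutset U|.
Proof. by rewrite !cardsX finset.setCK mulnC. Qed.

(** Summing x_a - x_d over all d gives cut {a} x, and likewise for c; hence
    cut {a} x + cut (~: {c}) x = |T| (x_a - x_c), while each cut is at most
    |T|. *)
Lemma cut_bound (R : realFieldType) (T : finType) (g : T -> R) (a c : T) :
  (forall U, U \in proper_sets T -> cut U g <= #|cutset U|%:R) ->
  g a - g c <= 2%:R.
Proof.
move=> gP; have [->|ac] := eqVneq a c; first by rewrite subrr.
have T0 : (0 : R) < #|T|%:R by rewrite ltr0n; apply/card_gt0P; exists a.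
have ga : cut [set a]%SET g <= #|T|%:R.
  apply: (le_trans (gP _ _)); last by rewrite ler_nat card_cutset1.
  by apply/proper_setsP; exists a, c; rewrite !inE eqxx eq_sym.
have gc : cut (~: [set c])%SET g <= #|T|%:R.
  apply: (le_trans (gP _ _)); last by rewrite ler_nat card_cutsetC card_cutset1.
  by apply/proper_setsP; exists a, c; rewrite !inE eqxx.
have e : cut [set a]%SET g + cut (~: [set c])%SET g = #|T|%:R * (g a - g c).
  rewrite cutC !cut1 -sumrB.
  under eq_bigr => x _ do rewrite opprB addrA subrK.
  by rewrite sumr_const mulr_natl.
rewrite -(ler_pM2l T0) -e mulr_natr mulr2n; exact: lerD.
Qed.

Lemma cut_gap (R : nzRingType) (T : finType) (U : {set T}) (g : T -> R) :
  #|cutset U|%:R - cut U g = \sum_(p in cutset U) (1 - (g p.1 - g p.2)).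
Proof. by rewrite sumrB sumr_const. Qed.

Lemma cut_le (R : realDomainType) (T : finType) (U : {set T}) (g : T -> R) :
  (forall a c, a \in U -> c \notin U -> g a - g c <= 1) ->
  cut U g <= #|cutset U|%:R.
Proof.
move=> gU; rewrite -subr_ge0 cut_gap sumr_ge0// => -[a c].
by rewrite !inE /= subr_ge0 => /andP[]; exact: gU.
Qed.

Lemma cut_ge (R : realDomainType) (T : finType) (U : {set T}) (g : T -> R) :
  (forall a c, a \in U -> c \notin U -> 1 <= g a - g c) ->
  #|cutset U|%:R <= cut U g.
Proof.
move=> gU; rewrite -subr_le0 cut_gap sumr_le0// => -[a c].
by rewrite !inE /= subr_le0 => /andP[]; exact: gU.
Qed.

(** Equality in either of the two termwise bounds above forces equality in
    each term. *)
Lemma cut_eq (R : realDomainType) (T : finType) (U : {set T}) (g : T -> R) :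
  (forall a c, a \in U -> c \notin U -> g a - g c <= 1) \/
  (forall a c, a \in U -> c \notin U -> 1 <= g a - g c) ->
  cut U g = #|cutset U|%:R ->
  forall a c, a \in U -> c \notin U -> g a - g c = 1.
Proof.
move=> gU e a c aU cU; have acU : (a, c) \in cutset U by rewrite !inE aU.
have := cut_gap U g; rewrite e subrr => /esym s0.
case: gU => gU.
  have /psumr_eq0P /(_ s0 _ acU) /= : forall p, p \in cutset U ->
      0 <= 1 - (g p.1 - g p.2).
    by case=> x y; rewrite !inE subr_ge0 => /andP[]; exact: gU.
  by move/subr0_eq.
have /psumr_eq0P H : forall p, p \in cutset U -> 0 <= - (1 - (g p.1 - g p.2)).
  by case=> x y; rewrite !inE oppr_ge0 subr_le0 => /andP[]; exact: gU.
have /H /(_ _ acU) /= /eqP : \sum_(p in cutset U) - (1 - (g p.1 - g p.2)) = 0.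
  by rewrite sumrN s0 oppr0.
by rewrite oppr_eq0 subr_eq0 => /eqP.
Qed.

(** U is a level set of g: integral values separated by a threshold differ by
    at least 1. *)
Lemma int_level_cut (R : archiRealDomainType) (T : finType) (g : T -> R)
    (a c : T) :
  (forall x, g x \is a Num.int) -> g a != g c ->
  exists2 U, U \in proper_sets T &
    forall x y, x \in U -> y \notin U -> 1 <= g x - g y.
Proof.
move=> g_int; wlog ltgca : a c / g c < g a => [hw|_].
  rewrite neq_lt => /orP [ltgac|ltgca]; last by apply: (hw a c); rewrite ?gt_eqF.
  by apply: (hw c a); rewrite ?gt_eqF.
exists [set x | g a <= g x]%SET.
  by apply/proper_setsP; exists a, c; rewrite !inE lexx -ltNge.
move=> x y; rewrite !inE -ltNge => ax ya.
have xy : 0 < g x - g y by rewrite subr_gt0 (lt_le_trans ya).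
by rewrite -(gtr0_norm xy) norm_intr_ge1 ?rpredB ?gt_eqF.
Qed.

(** * The polytope of cut inequalities *)

(** Cuts depend only on differences of coordinates; normalising the additional
    coordinate None to 0 makes them functionals of x. *)
Definition extend0 (R : zmodType) (n : nat) (x : 'cV[R]_n) : option 'I_n -> R :=
  oapp (fun j => x j ord0) 0.

(** The indicator of U, shifted by a constant so as to vanish at None. *)
Definition corner (R : nzRingType) (n : nat) (U : {set option 'I_n}) : 'cV[R]_n :=
  \col_j ((Some j \in U)%:R - (None \in U)%:R).

Definition cut_mx (R : nzRingType) (N n : nat) (U : 'I_N -> {set option 'I_n}) :
    'M[R]_(N, n) :=
  \matrix_(i, j) cut (U i) (extend0 (delta_mx j ord0)).

Definition cut_cap (R : nzRingType) (N n : nat) (U : 'I_N -> {set option 'I_n}) :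
    'cV[R]_N :=
  \col_i #|cutset (U i)|%:R.

Lemma extend0_sum (R : comNzRingType) (n : nat) (x : 'cV[R]_n) (a : option 'I_n) :
  \sum_j extend0 (delta_mx j ord0) a * x j ord0 = extend0 x a.
Proof.
case: a => [k|] /=; last by rewrite big1// => j _; rewrite mul0r.
rewrite (bigD1 k)//= mxE !eqxx mul1r big1 ?addr0// => j jk.
by rewrite mxE eq_sym (negPf jk) mul0r.
Qed.

Lemma cut_mxE (R : comNzRingType) (N n : nat) (U : 'I_N -> {set option 'I_n})
    (x : 'cV[R]_n) (i : 'I_N) :
  (cut_mx R U *m x) i ord0 = cut (U i) (extend0 x).
Proof.
rewrite mxE; under eq_bigr => j _ do rewrite mxE mulr_suml.
rewrite exchange_big; apply: eq_bigr => p _ /=.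
by under eq_bigr => j _ do rewrite mulrBl; rewrite sumrB !extend0_sum.
Qed.

Lemma extend0_int (R : realType) (n : nat) (x : 'cV[R]_n) (a : option 'I_n) :
  int_point x -> extend0 x a \is a Num.int.
Proof. by case: a => [j|] x_int /=; [exact: x_int|exact: rpred0]. Qed.

Lemma extend0_corner (R : nzRingType) (n : nat) (U : {set option 'I_n})
    (a : option 'I_n) :
  extend0 (corner R U) a = (a \in U)%:R - (None \in U)%:R.
Proof. by case: a => [j|] /=; rewrite ?mxE ?subrr. Qed.

Lemma corner_int (R : realType) (n : nat) (U : {set option 'I_n}) :
  int_point (corner R U).
Proof. by move=> i; rewrite mxE rpredB ?natr_int. Qed.

Lemma corner_diff (R : nzRingType) (n : nat) (U : {set option 'I_n})
    (a c : option 'I_n) :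
  extend0 (corner R U) a - extend0 (corner R U) c = (a \in U)%:R - (c \in U)%:R.
Proof. by rewrite !extend0_corner opprB addrA subrK. Qed.

Lemma cut_corner (R : realDomainType) (n : nat) (U : {set option 'I_n}) :
  cut U (extend0 (corner R U)) = #|cutset U|%:R.
Proof.
apply/eqP; rewrite eq_le cut_le ?cut_ge// => a c aU cU;
  by rewrite corner_diff aU (negPf cU) subr0.
Qed.

(** Equality would force every term of cut V to be 1, so that V is contained in
    U and the complement of V in that of U. *)
Lemma cut_corner_lt (R : realDomainType) (n : nat) (U V : {set option 'I_n}) :
  V \in proper_sets (option 'I_n) -> V != U ->
  cut V (extend0 (corner R U)) < #|cutset V|%:R.
Proof.
move=> /proper_setsP [a [c [aV cV]]] VU.
have le1 x y : x \in V -> y \notin V ->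
    extend0 (corner R U) x - extend0 (corner R U) y <= 1.
  move=> _ _; rewrite corner_diff.
  by case: (x \in U); case: (y \in U); rewrite /= ?subrr ?subr0 ?sub0r// lerN10.
rewrite lt_neqAle cut_le// andbT; apply: contra VU => /eqP e.
have {}e := cut_eq (or_introl le1) e.
have UV x y : x \in V -> y \notin V -> x \in U /\ y \notin U.
  move=> xV yV; have := e x y xV yV; rewrite corner_diff.
  case: (x \in U); case: (y \in U); rewrite //= ?subrr ?sub0r => /eqP.
  - by rewrite eq_sym oner_eq0.
  - by rewrite lt_eqF// (lt_trans _ ltr01)// oppr_lt0.
  - by rewrite eq_sym oner_eq0.
apply/eqP/setP => x; have [xV|xV] := boolP (x \in V).
  by have [-> _] := UV x c xV cV.
by have [_ /negPf->] := UV a x aV xV.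
Qed.

Lemma corner_unique (R : nzRingType) (n : nat) (U : {set option 'I_n})
    (x : 'cV[R]_n) :
  U \in proper_sets (option 'I_n) ->
  (forall a c, a \in U -> c \notin U -> extend0 x a - extend0 x c = 1) ->
  x = corner R U.
Proof.
move=> /proper_setsP [a [c [aU cU]]] xU.
apply/matrixP => j k; rewrite [k]ord1 {k} mxE.
have xE : x j ord0 = extend0 x (Some j) by [].
have [NU|NU] := boolP (None \in U).
  have H d : d \notin U -> extend0 x d = -1.
    by move=> dU; rewrite -(xU _ _ NU dU) /= sub0r opprK.
  have [jU|jU] := boolP (Some j \in U); last by rewrite xE H// sub0r.
  by rewrite subrr xE -[LHS](subrK (extend0 x c)) xU// H// subrr.
have H d : d \in U -> extend0 x d = 1.
  by move=> dU; rewrite -(xU _ _ dU NU) /= subr0.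
have [jU|jU] := boolP (Some j \in U); first by rewrite xE H// subr0.
have := xU _ _ aU jU; rewrite H// => /eqP.
by rewrite subrr xE subr_eq addrC -subr_eq subrr => /eqP.
Qed.

(** The two inequalities serve both bounds: the first one shows that 0 is alone
    once the right-hand sides are lowered, the second one identifies the
    nonzero integer points of the polytope. *)
Lemma int_point_cut (R : realType) (n : nat) (x : 'cV[R]_n) :
  int_point x -> x != 0 ->
  exists U, [/\ U \in proper_sets (option 'I_n),
    #|cutset U|%:R <= cut U (extend0 x) &
    cut U (extend0 x) <= #|cutset U|%:R -> x = corner R U].
Proof.
move=> x_int x0.
have [j xj] : exists j, x j ord0 != 0.
  apply: contrapT => /forallNP xj; move/negP: x0; apply; apply/eqP/matrixP => j k.
  by rewrite [k]ord1 mxE; apply/eqP/negPn/negP/xj.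
have [U U_proper xU] := int_level_cut (g := extend0 x) (a := Some j) (c := None)
  (fun a => extend0_int a x_int) xj.
exists U; split=> //; first exact: cut_ge.
move=> xle; apply: corner_unique => //; apply: cut_eq; first by right.
by apply/eqP; rewrite eq_le xle cut_ge.
Qed.

Definition enumerates_proper (N n : nat) (U : 'I_N -> {set option 'I_n}) :
    Prop :=
  injective U /\
  forall V, V \in proper_sets (option 'I_n) <-> exists i, U i = V.

Lemma enum_proper_sets (n : nat) :
  exists U : 'I_(2 * (2 ^ n - 1)) -> {set option 'I_n}, enumerates_proper U.
Proof.
have cardE : #|proper_sets (option 'I_n)| = (2 * (2 ^ n - 1))%N.
  by rewrite card_proper_sets ?card_option ?card_ord// expnS mulnBr muln1.
exists (fun i => enum_val (cast_ord (esym cardE) i)); split.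
  by move=> i j /enum_val_inj /cast_ord_inj.
move=> V; split=> [VP|[i <-]]; last exact: enum_valP.
exists (cast_ord cardE (enum_rank_in VP V)).
by rewrite cast_ordK enum_rankK_in.
Qed.

Lemma cut_mx0_lt (R : realType) (N n : nat) (U : 'I_N -> {set option 'I_n}) :
  enumerates_proper U ->
  forall i, (cut_mx R U *m (0 : 'cV[R]_n)) i ord0 < cut_cap R U i ord0.
Proof.
move=> [_ Uall] i; rewrite mulmx0 !mxE ltr0n; apply/card_gt0P.
have /proper_setsP [a [c [aU cU]]] : U i \in proper_sets (option 'I_n).
  by apply/Uall; exists i.
by exists (a, c); rewrite !inE aU.
Qed.

Lemma corner_tight_only_at (R : realType) (N n : nat)
    (U : 'I_N -> {set option 'I_n}) :
  enumerates_proper U ->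
  forall i, tight_only_at (cut_mx R U) (cut_cap R U) i (corner R (U i)).
Proof.
move=> [U_inj Uall] i; split; first by rewrite cut_mxE mxE cut_corner.
move=> j ji; rewrite cut_mxE mxE cut_corner_lt ?(inj_eq U_inj)//.
by apply/Uall; exists j.
Qed.

Lemma cut_polyhedron_int_points (R : realType) (N n : nat)
    (U : 'I_N -> {set option 'I_n}) (x : 'cV[R]_n) :
  enumerates_proper U ->
  polyhedron (cut_mx R U) (cut_cap R U) x -> int_point x ->
  x = 0 \/ exists i, x = corner R (U i).
Proof.
move=> [_ Uall] Px x_int; have [->|x0] := eqVneq x 0; [by left|right].
have [V [/Uall [i <-] _ xV]] := int_point_cut x_int x0.
by exists i; apply: xV; have := Px i; rewrite cut_mxE mxE.
Qed.

Lemma cut_polyhedron_bounded (R : realType) (N n : nat)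
    (U : 'I_N -> {set option 'I_n}) :
  enumerates_proper U ->
  bounded_set (polyhedron (cut_mx R U) (cut_cap R U)).
Proof.
move=> [_ Uall]; exists 2; split=> // M /ltW M2 x /= Px; apply: le_trans M2.
have xV V : V \in proper_sets (option 'I_n) ->
    cut V (extend0 x) <= #|cutset V|%:R.
  by move=> /Uall [i <-]; have := Px i; rewrite cut_mxE mxE.
rewrite /Num.norm /= mx_normrE; apply/bigmax_leP; split=> [//|[i j] _] /=.
rewrite [j]ord1 ler_norml.
have := cut_bound (Some i) None xV; have := cut_bound None (Some i) xV.
by rewrite /= subr0 sub0r; lra.
Qed.

(** Lowering the right-hand sides by 1 keeps the integer points that satisfied
    them strictly, as cuts of integer points are integers: 0 stays, and the
    corner of U i violates row i only. A subsystem that omits row i thus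
    admits this corner, so all the N rows are needed. *)
Lemma helly_bound1_ge (R : realType) (N n : nat)
    (U : 'I_N -> {set option 'I_n}) (c : nat) :
  enumerates_proper U -> helly_bound R n 1 c -> (N <= c)%N.
Proof.
move=> UP Hc; pose A := cut_mx R U; pose b := cut_cap R U - const_mx 1.
have int_lt x i : int_point x -> (A *m x) i ord0 < cut_cap R U i ord0 ->
    (A *m x) i ord0 <= b i ord0.
  move=> x_int; rewrite /b !mxE.
  have -> : \sum_j A i j * x j ord0 = cut (U i) (extend0 x).
    by rewrite -cut_mxE mxE.
  have /intrP [k ->] : cut (U i) (extend0 x) \is a Num.int.
    by apply: rpred_sum => p _; rewrite rpredB ?extend0_int.
  rewrite -[#|_|%:R]/(#|cutset (U i)|%:Z%:~R) -[1 in X in _ -> X]/(1%:~R) -intrB.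
  by rewrite ltr_int ler_int; lia.
have b0 : polyhedron A b 0.
  by move=> i; apply: int_lt; [move=> k; rewrite mxE rpred0|exact: cut_mx0_lt].
have only0 : polyhedron A b `&` @int_point R n = [set 0].
  apply/seteqP; split=> [x [Px x_int]|_ ->]; last first.
    by split=> // k; rewrite mxE rpred0.
  apply: contrapT => /eqP x0.
  have [V [/UP.2 [i <-] xV _]] := int_point_cut x_int x0.
  have := Px i; rewrite /A cut_mxE !mxE; lra.
have [|S [Sc]] := Hc N A b; first by rewrite only0; exact: card_set1.
rewrite only0 => SE; suff ST : S = [set: 'I_N]%SET.
  by rewrite ST cardsT card_ord in Sc.
apply/setP => i; rewrite finset.in_setT; apply/negPn/negP => iS.
have [iE ilt] := corner_tight_only_at R UP i.
have : (polyhedron_on A b S `&` @int_point R n) (corner R (U i)).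
  split; last exact: corner_int.
  move=> j jS; apply: int_lt; first exact: corner_int.
  by apply: ilt; apply: contraNneq iS => <-.
rewrite SE /= => c0; have := cut_mx0_lt R UP i.
by rewrite -c0 iE ltxx.
Qed.

(** * The number of facets and the value of the constant *)

Lemma facets_card (R : realType) (m n : nat) (A : 'M[R]_(m, n)) (b : 'cV[R]_m)
    (P : set 'cV[R]_n) :
  facet_description A b P -> facets P #= `I_m.
Proof.
move=> [_ [fun_t inj_t surj_t]].
set f := (fun i => _) in fun_t inj_t surj_t.
have -> : facets P = [set f i | i in [set: 'I_m]].
  by apply/seteqP; split=> [G /surj_t//|_ [i iT <-]]; exact: fun_t.
by rewrite (card_eql (inj_card_eq inj_t)) card_eq_sym card_II.
Qed.

Lemma c_upper1 (n : nat) : Posz (2 * (2 ^ n - 1)) = c_upper n 1.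
Proof.
have -> : c_upper n 1 = 2 * 2 ^+ n - 2 * 2 + 2.
  rewrite /c_upper; suff -> : Num.ceil ((2 * (1 + 1))%N%:R / 3%:R : rat) = 2 by [].
  by apply: ceil_def.
have : (0 < 2 ^ n)%N by rewrite expn_gt0.
have -> : (2 : int) ^+ n = (2 ^ n)%N by rewrite -natrX natz.
by lia.
Qed.

Theorem theorem2 (R : realType) (n : nat) (n_gt0 : (0 < n)%N) :
  (exists P : set 'cV[R]_n,
    [/\ polytope P,
        interior P `&` @int_point R n #= `I_1,
        facets P #= `I_(2 * (2 ^ n - 1))
      & forall F, facets P F -> rel_interior F `&` @int_point R n #= `I_1]
    /\ (exists (A : 'M[R]_(2 * (2 ^ n - 1), n)) (b : 'cV[R]_(2 * (2 ^ n - 1))),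
          facet_description A b P)
    /\ (forall (m : nat) (A : 'M[R]_(m, n)) (b : 'cV[R]_m),
          facet_description A b P ->
          forall i : 'I_m, exists z : 'cV[R]_n,
            [/\ int_point z,
                interior (polyhedron_on A b [set~ i]%SET) z
              & ~ interior P z]))
  /\ is_c R n 1 (2 * (2 ^ n - 1))
  /\ Posz (2 * (2 ^ n - 1)) = c_upper n 1.
Proof.
have [U UP] := enum_proper_sets n.
split; last first.
  split; last exact: c_upper1.
  by split=> [|c]; [exact: helly_bound1|move=> /(helly_bound1_ge UP)].
pose A := cut_mx R U; pose b := cut_cap R U; pose P := polyhedron A b.
have A0 : forall i, (A *m (0 : 'cV[R]_n)) i ord0 < b i ord0.
  exact: cut_mx0_lt.
have corner_tight := corner_tight_only_at R UP.
have PA : facet_description A b P.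
  exact: irredundant_facet_description A0 corner_tight.
have facetP F : facets P F -> exists i, F = tight_at A b i.
  by case: PA => _ [_ _ /[apply]] [i _ <-]; exists i.
have corner_facet F i : facets P F -> F (corner R (U i)) -> F = tight_at A b i.
  move=> /facetP [j ->] Fi.
  by rewrite (tight_only_at_uniq (corner_tight i) Fi).
have int0 : int_point (0 : 'cV[R]_n) by move=> k; rewrite mxE rpred0.
have corner_boundary i : ~ interior P (corner R (U i)).
  exact: tight_not_interior (A0 i) (corner_tight i).1.
exists P; split; [split|split].
- split; last exact: cut_polyhedron_bounded.
  by exists (2 * (2 ^ n - 1))%N, A, b.
- suff -> : interior P `&` @int_point R n = [set 0] by exact: card_set1.
  apply/seteqP; split=> [x [Px x_int]|_ ->]; last first.
    split=> //; rewrite /P -polyhedron_onT.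
    by apply: interior_polyhedron_on => i _; exact: A0.
  have [//|[i xi]] := cut_polyhedron_int_points UP (interior_subset Px) x_int.
  by case: (corner_boundary i); rewrite -xi.
- exact: facets_card PA.
- move=> F /facetP [i ->].
  suff -> : rel_interior (tight_at A b i) `&` @int_point R n =
      [set corner R (U i)] by exact: card_set1.
  apply/seteqP; split=> [x [[xi _] x_int]|_ ->]; last first.
    by split; [exact: rel_interior_tight|exact: corner_int].
  have [x0|[j xj]] := cut_polyhedron_int_points UP xi.1 x_int.
    by have := A0 i; rewrite -x0 xi.2 ltxx.
  by rewrite /= xj (tight_only_at_uniq (corner_tight j) (i:=j) (j:=i)) -?xj.
- by exists A, b.
- move=> m A' b' PA' i'.
  have F' : facets P (tight_at A' b' i').
    by have [PE [fun_t _ _]] := PA'; have := fun_t i' I; rewrite {2}PE.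
  have [i FE] := facetP _ F'.
  have Fi : tight_at A' b' i' (corner R (U i)).
    by rewrite FE; exact: tight_only_at_mem.
  exists (corner R (U i)); split=> //; first exact: corner_int.
  apply: (facet_description_drop PA' Fi) => G FG Gi.
  by rewrite FE; exact: corner_facet.
Qed.
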